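(* Let $v_1(t),\dots,v_N(t)$ be a (differentiable in time) solution, on a time interval during which the batches are fixed, of the semi-discrete random batch particle system of type I $$\frac{\mathrm{d}v_i(t)}{\mathrm{d}t}=-\frac{N-1}{p-1}\sum_{j=1}^N w_j I_{ij}A(v_i-v_j)B_{ij}^N,\qquad i=1,\dots,N,$$ where $B_{ij}^N=\nabla\frac{\delta E_\epsilon^N}{\delta f}(v_i)-\nabla\frac{\delta E_\epsilon^N}{\delta f}(v_j)$ and $$\nabla\frac{\delta E_\epsilon^N}{\delta f}(v)=\int_{\mathbb{R}^d}\nabla\psi_\epsilon(v-u)\log\Big(\sum_{k=1}^N w_k\psi_\epsilon(u-v_k)\Big)\,\mathrm{d}u .$$ Then: 1. (Conservation of mass, momentum and energy) $\displaystyle\frac{\mathrm{d}}{\mathrm{d}t}\sum_{i=1}^N w_i\phi(v_i)=0$ for $\phi(v)=1$, $\phi(v)=v$ and $\phi(v)=|v|^2$. 2. (Dissipation of entropy) With $$E_\epsilon^N=\int_{\mathbb{R}^d}\Big(\sum_{i=1}^N w_i\psi_\epsilon(v-v_i)\Big)\log\Big(\sum_{k=1}^N w_k\psi_\epsilon(v-v_k)\Big)\,\mathrm{d}v,$$ one has $\displaystyle\frac{\mathrm{d}E_\epsilon^N}{\mathrm{d}t}=-D_\epsilon^*\le 0$, where $$D_\epsilon^*=\frac{N-1}{2(p-1)}\sum_{i=1}^N\sum_{j=1}^N w_iw_jI_{ij}\,B_{ij}^N\cdot A(v_i-v_j)B_{ij}^N .$$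
   Context: Let $d\ge 2$, $\Lambda>0$, $-d-1\le\gamma\le 1$, and let $A(z)=\Lambda|z|^\gamma(|z|^2I_d-z\otimes z)$ for $z\in\mathbb{R}^d$; this is a symmetric positive semi-definite matrix with $A(z)=A(-z)$ and $A(z)z=0$. Let $\epsilon>0$ and let $\psi_\epsilon(v)=(2\pi\epsilon)^{-d/2}\exp(-|v|^2/(2\epsilon))$ on $\mathbb{R}^d$. $N$ particles have velocities $v_i(t)\in\mathbb{R}^d$ and time-independent weights $w_i>0$. The index set $\{1,\dots,N\}$ is partitioned into $q=N/p$ batches, each of size $p$ ($2\le p\le N$, $p$ divides $N$). In the method the partition is drawn at random at the beginning of each time step and kept fixed during that step; the statement holds for every partition. The indicator is $I_{ij}=1$ if $i,j$ are in the same batch and $I_{ij}=0$ otherwise (so $I_{ij}=I_{ji}$). Convention: when $v_i=v_j$ (in particular when $i=j$), in which case $B_{ij}^N=0$, the expression $A(v_i-v_j)B_{ij}^N$ is taken to be $0$. *)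

(* Defs.v *)
From HB Require Import structures.
From mathcomp Require Import all_boot all_order all_algebra.
From mathcomp Require Import all_classical all_reals all_analysis.

Set Implicit Arguments.
Unset Strict Implicit.
Unset Printing Implicit Defensive.

Import Order.TTheory GRing.Theory Num.Theory.
Import numFieldNormedType.Exports.

Local Open Scope classical_set_scope.
Local Open Scope ring_scope.

Section lebesgue_tuple.
Variable R : realType.
Local Notation TR := (measurableTypeR R).

Definition cons_pair n (x : TR * n.-tuple TR) : n.+1.-tuple TR :=
  [the n.+1.-tuple TR of x.1 :: x.2].

Lemma measurable_cons_pair n : measurable_fun [set: _] (@cons_pair n).
Proof. by apply: measurable_cons; [exact: measurable_fst|exact: measurable_snd]. Qed.

Section step.
Variables (n : nat) (mu : {sigma_finite_measure set (n.-tuple TR) -> \bar R}).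

Definition lebesgue_cons : set (n.+1.-tuple TR) -> \bar R :=
  pushforward (@lebesgue_measure R \x mu)%E (@cons_pair n).

Let preimage_measurable A :
  measurable A -> measurable (@cons_pair n @^-1` A).
Proof. by move=> mA; rewrite -[_ @^-1` _]setTI; exact: measurable_cons_pair. Qed.

Let lebesgue_cons0 : lebesgue_cons set0 = 0%E.
Proof. by rewrite /lebesgue_cons /pushforward preimage_set0 measure0. Qed.

Let lebesgue_cons_ge0 A : (0 <= lebesgue_cons A)%E.
Proof. by rewrite /lebesgue_cons /pushforward measure_ge0. Qed.

Let lebesgue_cons_sigma_additive : semi_sigma_additive lebesgue_cons.
Proof.
move=> F mF tF mUF; rewrite /lebesgue_cons /pushforward preimage_bigcup.
apply: measure_semi_sigma_additive.
- by move=> k; exact: preimage_measurable.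
- apply/trivIsetP => i j _ _ ij; rewrite -preimage_setI.
  by move/trivIsetP : tF => /(_ _ _ _ _ ij) ->//; rewrite preimage_set0.
- by rewrite -preimage_bigcup; exact: preimage_measurable.
Qed.

HB.instance Definition _ := isMeasure.Build _ _ _ lebesgue_cons
  lebesgue_cons0 lebesgue_cons_ge0 lebesgue_cons_sigma_additive.

Lemma sigma_finite_lebesgue_cons : sigma_finite setT lebesgue_cons.
Proof.
have /sigma_finiteP[F [TF ndF Foo]] := sigma_finiteT (@lebesgue_measure R).
have /sigma_finiteP[G [TG ndG Goo]] := sigma_finiteT mu.
pose u (t : n.+1.-tuple TR) : TR * n.-tuple TR :=
  (tnth t ord0, [tuple of behead t]).
have mu_ : measurable_fun [set: _] u.
  apply/measurable_fun_pairP; split; first exact: measurable_tnth.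
  exact: measurable_behead.
have cK (x : TR * n.-tuple TR) : u (cons_pair x) = x.
  by case: x => a b; rewrite /u /cons_pair; congr pair; apply/val_inj.
exists (fun k => u @^-1` (F k `*` G k)).
  rewrite -preimage_bigcup -[LHS](preimage_setT u); congr (_ @^-1` _).
  rewrite -setXTT TF TG predeqE => -[x y]; split; last first.
    by move=> [k _ []/= ? ?]; split; exists k.
  move=> [/= [k _ Fkx] [l _ Gly]]; exists (maxn k l) => //; split.
  - by move: x Fkx; exact/subsetPset/ndF/leq_maxl.
  - by move: y Gly; exact/subsetPset/ndG/leq_maxr.
move=> k; have [mF finF] := Foo k; have [mG finG] := Goo k; split.
  by rewrite -[_ @^-1` _]setTI; apply: mu_ => //; exact: measurableX.
rewrite /lebesgue_cons /pushforward -comp_preimage.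
rewrite (_ : u \o _ = id); last by apply/funext => x /=; rewrite cK.
by rewrite preimage_id product_measure1E// lte_mul_pinfty// ge0_fin_numE.
Qed.

HB.instance Definition _ :=
  Measure_isSigmaFinite.Build _ _ _ lebesgue_cons sigma_finite_lebesgue_cons.

End step.

(* Lebesgue measure on R^n as the n-fold product measure: the library only has
   binary products, hence the transport along (a, t) |-> a :: t. *)
Fixpoint lebesgue_tuple n : {sigma_finite_measure set (n.-tuple TR) -> \bar R} :=
  match n with
  | 0 => [the {sigma_finite_measure set _ -> \bar R} of
            \d_([tuple] : 0.-tuple TR)]
  | m.+1 => [the {sigma_finite_measure set _ -> \bar R} of
               lebesgue_cons (lebesgue_tuple m)]
  end.

End lebesgue_tuple.

Section euclidean_space.
Variables (R : realType) (d : nat).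
Implicit Types u v z : 'cV[R]_d.

Definition col_of_tuple (x : d.-tuple (measurableTypeR R)) : 'cV[R]_d :=
  \col_i tnth x i.

Definition integral_Rd (f : 'cV[R]_d -> R) : R :=
  \int[lebesgue_tuple R d]_x f (col_of_tuple x).

Definition dotv u v : R := \sum_i u i 0 * v i 0.

(* The library norm `|v| on matrices is the sup norm, not this one. *)
Definition enorm v : R := Num.sqrt (dotv v v).

Definition gradient (f : 'cV[R]_d -> R) v : 'cV[R]_d :=
  \col_i 'D_(delta_mx i 0) f v.

(* A vanishes at z = 0 for every gamma: the library power 0 `^ gamma is a
   finite number, and it multiplies the zero matrix. *)
Definition collision_matrix (Lambda gamma : R) z : 'M[R]_d :=
  (Lambda * enorm z `^ gamma) *: ((enorm z ^+ 2)%:M - z *m z^T).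

Definition gaussian (eps : R) v : R :=
  (2 * pi * eps) `^ (- (d%:R / 2)) * expR (- (enorm v ^+ 2 / (2 * eps))).

End euclidean_space.

(* The derivative of f : J -> V at t: two-sided when t is interior to J, and
   one-sided at an endpoint belonging to J. *)
Definition is_derive_on (R : realType) (V : normedModType R) (J : interval R)
    (f : R -> V) (t : R) (l : V) : Prop :=
  (fun s => (s - t)^-1 *: (f s - f t)) @ within [set` J] t^' --> l.

Section particles.
Variables (R : realType) (d N : nat).
Variables (eps : R) (w : 'I_N -> R) (x : 'I_N -> 'cV[R]_d).

Definition mollified_density (u : 'cV[R]_d) : R :=
  \sum_k w k * gaussian eps (u - x k).

Definition entropy : R :=
  integral_Rd (fun u => mollified_density u * ln (mollified_density u)).

Definition grad_entropy_variation (v : 'cV[R]_d) : 'cV[R]_d :=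
  \col_l integral_Rd (fun u =>
    gradient (@gaussian R d eps) (v - u) l 0 * ln (mollified_density u)).

Definition entropy_force (i j : 'I_N) : 'cV[R]_d :=
  grad_entropy_variation (x i) - grad_entropy_variation (x j).

End particles.

Section batches.
Variables (R : realType) (d N : nat).

Definition is_batching (p : nat) (P : {set {set 'I_N}}) : Prop :=
  [/\ finset.partition P [set: 'I_N]%SET, #|P| = (N %/ p)%N
    & forall C, C \in P -> #|C| = p].

Definition same_batch (P : {set {set 'I_N}}) (i j : 'I_N) : bool :=
  [exists C in P, (i \in C) && (j \in C)].

Variables (Lambda gamma eps : R) (p : nat) (P : {set {set 'I_N}}).
Variables (w : 'I_N -> R) (x : 'I_N -> 'cV[R]_d).

Definition batch_velocity (i : 'I_N) : 'cV[R]_d :=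
  - ((N%:R - 1) / (p%:R - 1)) *:
    \sum_j (w j * (same_batch P i j)%:R) *:
      (collision_matrix Lambda gamma (x i - x j) *m entropy_force eps w x i j).

Definition batch_dissipation : R :=
  (N%:R - 1) / (2 * (p%:R - 1)) *
    \sum_i \sum_j w i * w j * (same_batch P i j)%:R *
      dotv (entropy_force eps w x i j)
        (collision_matrix Lambda gamma (x i - x j)
           *m entropy_force eps w x i j).

End batches.

(* Main.v *)
Require Import Defs.
From mathcomp Require Import all_boot all_order all_algebra.
From mathcomp Require Import all_classical all_reals all_analysis.
From mathcomp Require Import measurable_realfun.
From mathcomp Require Import ring lra.

Set Implicit Arguments.
Unset Strict Implicit.
Unset Printing Implicit Defensive.

Import Order.TTheory GRing.Theory Num.Theory.
Import numFieldNormedType.Exports.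

Local Open Scope classical_set_scope.
Local Open Scope ring_scope.

(** Momentum, energy and entropy all come from one identity. The interaction
    [A (x i - x j) *m B i j] is antisymmetric in [i] and [j], because [A] is
    even, [B j i = - B i j], and the batch relation is symmetric. Hence, for any
    vectors [g i], the sum of [w i * dotv (g i) (d x i / dt)] only sees the
    differences [g i - g j] ([batch_velocity_weak]). With [g] constant it
    vanishes: momentum. With [g = x] it vanishes because [A z] is symmetric
    and annihilates [z]: energy. With [g i] the gradient of the entropy
    variation at [x i], the difference is [B i j] itself and the sum is minus
    the dissipation, which is nonnegative because [A] is positive
    semi-definite (Cauchy-Schwarz).

    What remains is the chain rule ([is_derive_entropy]): the derivative of the
    entropy along a curve of positions is the sum of
    [w k * dotv (grad_entropy_variation (x k)) (d x k / dt)]. Formally one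
    differentiates [rho * ln rho] under the integral, discards the integral of
    the derivative of [rho], and moves the derivative of the Gaussian onto the
    other variable. The discarding is done beforehand: the Gaussian is a product
    of normal densities, so by Tonelli the integral of [rho] is the constant
    [\sum_k w k], and the entropy is that constant plus the integral of
    [rho * ln rho - rho], whose derivative in [rho] is [ln rho].

    Differentiation under the integral is dominated convergence for the
    difference quotients along a sequence of times. The curve is only
    differentiable at the time considered, so the domination must come from the
    positions: for positions in a ball, [rho] lies between two Gaussians, so
    [ln rho] grows at most quadratically, and [rho] is Lipschitz in the
    positions with a constant that decays like a Gaussian in space. As
    [y * ln y - y] is convex with derivative [ln y], the increments of the
    integrand are at most [|t - s|] times a polynomial times a Gaussian, hence
    at most [|t - s|] times a wider Gaussian
    ([entropy_integrand_density_lipschitz]), and Gaussians are integrable.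

    At an endpoint of the time interval derivatives are one-sided. A curve is
    therefore first extended off the interval by its tangent line, which turns
    each one-sided derivative into an ordinary one. *)

(** * One-sided derivatives along an interval *)

Section derivatives_on_intervals.
Context {R : realType} {V : normedModType R}.
Implicit Types (J : interval R) (f g : R -> V) (t : R) (l : V).

Lemma is_derive1P f t l :
  is_derive t 1 f l <-> (fun s => (s - t)^-1 *: (f s - f t)) @ t^' --> l.
Proof.
have shiftE : (fun h : R => h^-1 *: ((f \o shift t) (h *: 1) - f t)) @ 0^'
    = (fun s => (s - t)^-1 *: (f s - f t)) @ t^'.
  apply/seteqP; split => A /= [e /= e0 eA]; exists e => //= x xe xt.
    have := eA (x - t); rewrite /= /ball_/= !sub0r !normrN => /(_ _ _).
    rewrite scaler1 /shift/= subrK; apply; first by rewrite distrC.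
    by rewrite subr_eq0.
  have := eA (x + t); rewrite /= scaler1 addrK; apply.
    move: xe; rewrite /ball_/= sub0r normrN.
    by rewrite opprD addrCA subrr addr0 normrN.
  by rewrite -subr_eq0 addrK.
rewrite -shiftE; split => [[df <-]|fl]; first exact: df.
apply: DeriveDef; first by apply/cvg_ex; exists l.
exact/cvg_lim.
Qed.

(** Continuing [f] by its tangent line outside [J] gives a function with a
    two-sided derivative at [t], to which the usual rules apply. *)
Lemma is_derive_on_extension J f t l : is_derive_on J f t l -> t \in J ->
  exists2 g : R -> V, is_derive t 1 g l & {in J, g =1 f}.
Proof.
move=> fl tJ.
exists (fun s => if s \in J then f s else f t + (s - t) *: l); last first.
  by move=> s /= ->.
apply/is_derive1P/cvgrPdist_le => e e0 /=; rewrite tJ.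
move/cvgrPdist_le : fl => /(_ e e0); rewrite near_withinE => fle.
near=> s; case: ifPn => sJ.
  by have : [set` J] s by []; near: s.
rewrite [f t + _]addrC addrK scalerA mulVf ?scale1r ?subrr ?normr0 1?ltW//.
by rewrite subr_eq0; near: s; exact: nbhs_dnbhs_neq.
Unshelve. all: by end_near. Qed.

Lemma is_derive_is_derive_on J f g t l : is_derive t 1 g l ->
  t \in J -> {in J, g =1 f} -> is_derive_on J f t l.
Proof.
move=> /is_derive1P gl tJ gf; rewrite /is_derive_on.
move/cvgrPdist_le : gl => gl; apply/cvgrPdist_le => e e0.
rewrite near_withinE; near=> s => /= sJ; rewrite -!gf//.
by near: s; exact: gl.
Unshelve. all: by end_near. Qed.

End derivatives_on_intervals.

(** * The collision matrix and the weak form of the batch dynamics *)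

Section collision_algebra.
Context {R : realType} {d : nat}.
Implicit Types (u v z : 'cV[R]_d) (Lambda gamma : R).

Lemma dotvE u v : dotv u v = (u^T *m v) 0 0.
Proof. by rewrite mxE; apply: eq_bigr => i _; rewrite mxE. Qed.

Lemma dotvC u v : dotv u v = dotv v u.
Proof. by apply: eq_bigr => i _; rewrite mulrC. Qed.

Lemma dotvDr u v z : dotv u (v + z) = dotv u v + dotv u z.
Proof. by rewrite -big_split; apply: eq_bigr => i _; rewrite mxE mulrDr. Qed.

Lemma dotvZr (a : R) u v : dotv u (a *: v) = a * dotv u v.
Proof. by rewrite mulr_sumr; apply: eq_bigr => i _; rewrite mxE mulrCA. Qed.

Lemma dotvNr u v : dotv u (- v) = - dotv u v.
Proof. by rewrite -scaleN1r dotvZr mulN1r. Qed.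

Lemma dotvBr u v z : dotv u (v - z) = dotv u v - dotv u z.
Proof. by rewrite dotvDr dotvNr. Qed.

Lemma dotv_sumr I (r : seq I) (Q : pred I) (F : I -> 'cV[R]_d) u :
  dotv u (\sum_(i <- r | Q i) F i) = \sum_(i <- r | Q i) dotv u (F i).
Proof.
elim/big_rec2: _ => [|i x y _ <-]; last by rewrite dotvDr.
by rewrite /dotv big1// => i _; rewrite mxE mulr0.
Qed.

Lemma dotv_ge0 u : 0 <= dotv u u.
Proof. by apply: sumr_ge0 => i _; exact: sqr_ge0. Qed.

Lemma enorm_sqr u : enorm u ^+ 2 = dotv u u.
Proof. by rewrite sqr_sqrtr// dotv_ge0. Qed.

Lemma dotv_delta u l : dotv u (delta_mx l 0) = u l 0.
Proof.
rewrite /dotv (bigD1 l)//= mxE !eqxx mulr1 big1 ?addr0// => i il.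
by rewrite mxE (negbTE il) mulr0.
Qed.

Lemma enormN u : enorm (- u) = enorm u.
Proof. by rewrite /enorm dotvNr dotvC dotvNr opprK. Qed.

(** Cauchy-Schwarz, in the form of Lagrange's identity. *)
Lemma dotv_sqr_le u v : dotv u v ^+ 2 <= dotv u u * dotv v v.
Proof.
have : 0 <= \sum_i \sum_j (u i 0 * v j 0 - u j 0 * v i 0) ^+ 2.
  by apply: sumr_ge0 => i _; apply: sumr_ge0 => j _; exact: sqr_ge0.
suff -> : \sum_i \sum_j (u i 0 * v j 0 - u j 0 * v i 0) ^+ 2 =
    2 * (dotv u u * dotv v v - dotv u v ^+ 2).
  by rewrite pmulr_rge0// subr_ge0.
transitivity (\sum_i (u i 0 * u i 0 * dotv v v + v i 0 * v i 0 * dotv u u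
    - u i 0 * v i 0 * (2 * dotv u v))).
  apply: eq_bigr => i _; rewrite /dotv !mulr_sumr -big_split -sumrB.
  by apply: eq_bigr => j _; rewrite /=; ring.
rewrite sumrB big_split/= -!mulr_suml -/(dotv u u) -/(dotv v v) -/(dotv u v).
by ring.
Qed.

Lemma collision_matrixE Lambda gamma z v :
  collision_matrix Lambda gamma z *m v =
  (Lambda * enorm z `^ gamma) *: (dotv z z *: v - dotv z v *: z).
Proof.
rewrite /collision_matrix -scalemxAl mulmxBl mul_scalar_mx enorm_sqr.
by rewrite -mulmxA [z^T *m v]mx11_scalar -dotvE mul_mx_scalar.
Qed.

Lemma collision_matrixN Lambda gamma z :
  collision_matrix Lambda gamma (- z) = collision_matrix Lambda gamma z.
Proof. by rewrite /collision_matrix enormN linearN/= mulmxN mulNmx opprK. Qed.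

(** No momentum is exchanged along the relative velocity: this is what
    conserves the energy. *)
Lemma dotv_collision_matrix Lambda gamma z v :
  dotv z (collision_matrix Lambda gamma z *m v) = 0.
Proof. by rewrite collision_matrixE dotvZr dotvBr !dotvZr; ring. Qed.

(** Up to a nonnegative factor, the quadratic form is the defect in the
    Cauchy-Schwarz inequality. *)
Lemma collision_matrix_ge0 Lambda gamma z v : 0 <= Lambda ->
  0 <= dotv v (collision_matrix Lambda gamma z *m v).
Proof.
move=> L0; rewrite collision_matrixE dotvZr mulr_ge0 ?mulr_ge0 ?powR_ge0//.
by rewrite dotvBr !dotvZr subr_ge0 (dotvC v z) -expr2 dotv_sqr_le.
Qed.

End collision_algebra.

Section weak_form.
Context {R : realType} {d N : nat}.
Variables (Lambda gamma eps : R) (p : nat) (P : {set {set 'I_N}}).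
Variables (w : 'I_N -> R) (x : 'I_N -> 'cV[R]_d).

Local Notation A i j := (collision_matrix Lambda gamma (x i - x j)).
Local Notation B := (entropy_force eps w x).

Lemma same_batchC i j : same_batch P i j = same_batch P j i.
Proof. by apply: eq_existsb => C; rewrite [(i \in C) && _]andbC. Qed.

(** Exchanging [i] and [j] flips the sign of the interaction
    [A (x i - x j) *m B i j], so testing the velocities against any [g]
    only involves the differences [g i - g j]. Constant [g], [g = x] and
    [g = grad_entropy_variation] give momentum, energy and entropy. *)
Lemma batch_velocity_weak (g : 'I_N -> 'cV[R]_d) :
  \sum_i w i * dotv (g i) (batch_velocity Lambda gamma eps p P w x i) =
  - ((N%:R - 1) / (2 * (p%:R - 1)) *
    \sum_i \sum_j w i * w j * (same_batch P i j)%:R *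
       dotv (g i - g j) (A i j *m B i j)).
Proof.
set k := N%:R - 1; set q := p%:R - 1.
pose S i j := w i * w j * (same_batch P i j)%:R.
pose F i j := S i j * dotv (g i) (A i j *m B i j).
have BN i j : B j i = - B i j by rewrite opprB.
have FN : \sum_i \sum_j S i j * dotv (g j) (A i j *m B i j) =
    - \sum_i \sum_j F i j.
  rewrite exchange_big -sumrN; apply: eq_bigr => i _.
  rewrite -sumrN; apply: eq_bigr => j _.
  rewrite /F /S same_batchC (mulrC (w j)) -(opprB (x i)) collision_matrixN.
  by rewrite BN mulmxN dotvNr mulrN.
have -> : \sum_i \sum_j w i * w j * (same_batch P i j)%:R *
    dotv (g i - g j) (A i j *m B i j) = 2 * \sum_i \sum_j F i j.
  rewrite -[RHS]opprK -mulrN -FN mulr_sumr.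
  transitivity (\sum_i \sum_j F i j -
      \sum_i \sum_j S i j * dotv (g j) (A i j *m B i j)); last first.
    by rewrite FN -mulr_sumr FN; ring.
  rewrite -sumrB; apply: eq_bigr => i _; rewrite -sumrB; apply: eq_bigr => j _.
  by rewrite dotvC dotvBr mulrBr /F ![dotv (A _ _ *m _) _]dotvC.
have -> : k / (2 * q) * (2 * \sum_i \sum_j F i j) = k / q * \sum_i \sum_j F i j.
  by rewrite invfM; move: q^-1 => r; field.
rewrite -mulNr mulr_sumr; apply: eq_bigr => i _.
rewrite dotvZr mulrCA dotv_sumr -/k -/q; congr (_ * _); rewrite !mulr_sumr.
by apply: eq_bigr => j _; rewrite dotvZr /F /S; ring.
Qed.

End weak_form.

(** * Gaussian integrals on the tuple space *)

Section lebesgue_tuple_integral.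
Context {R : realType}.
Local Notation mu := (@lebesgue_measure R).
Local Notation TR := (measurableTypeR R).
Local Open Scope ereal_scope.

(** Tonelli's theorem, one coordinate at a time: [lebesgue_tuple] is by
    construction a pushforward of a binary product measure. *)
Lemma integral_lebesgue_tuple_prod n (h : 'I_n -> R -> R) :
  (forall i, measurable_fun setT (h i)) -> (forall i y, 0 <= h i y)%R ->
  \int[lebesgue_tuple R n]_x (\prod_i h i (tnth x i))%:E =
  \prod_i \int[mu]_y (h i y)%:E.
Proof.
elim: n h => [|n IHn] h mh h0.
  rewrite big_ord0; under eq_integral do rewrite big_ord0.
  by rewrite /= integral_cst//= diracT mul1e.
have mprod m (k : 'I_m -> R -> R) : (forall i, measurable_fun setT (k i)) ->
    measurable_fun setT (fun x : m.-tuple TR => \prod_i k i (tnth x i))%R.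
  move=> mk; apply: measurable_prod => i _.
  by apply: (measurableT_comp (mk i)); exact: measurable_tnth.
have prod0 m (k : 'I_m -> R -> R) (x : m.-tuple TR) :
    (forall i y, 0 <= k i y)%R -> 0 <= (\prod_i k i (tnth x i))%:E.
  by move=> k0; rewrite lee_fin; apply: prodr_ge0 => i _; exact: k0.
apply: etrans.
  apply: (@ge0_integral_pushforward _ _ _ _ R (@cons_pair R n)
    (@measurable_cons_pair R n) (mu \x lebesgue_tuple R n) setT
    (fun x => (\prod_i h i (tnth x i))%:E)) => //.
  - apply/measurable_EFinP; apply: mprod => i; exact: mh.
  - by move=> x _; exact: prod0.
rewrite preimage_setT.
pose k i := h (lift ord0 i).
have k0 x : 0 <= (\prod_i k i (tnth x i))%:E by apply: prod0 => i; exact: h0.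
pose F (z : TR * n.-tuple TR) :=
  (h ord0 z.1 * \prod_i k i (tnth z.2 i))%R.
transitivity (\int[mu \x lebesgue_tuple R n]_z (F z)%:E).
  apply: eq_integral => z _ /=; rewrite big_ord_recl; congr (_ * _)%:E.
  by apply: eq_bigr => i _; rewrite tnthS.
have F0 z : 0 <= (F z)%:E by rewrite EFinM mule_ge0 ?k0 ?lee_fin.
rewrite fubini_tonelli1//; last first.
  apply/measurable_EFinP/measurable_funM.
    exact: (measurableT_comp (mh ord0)).
  apply: (measurableT_comp (mprod _ k _)) => // i; exact: mh.
rewrite /fubini_F big_ord_recl -IHn ?(fun i => mh (lift ord0 i))//.
rewrite -ge0_integralZr//=.
- apply: eq_integral => y _; rewrite /F /=.
  under eq_integral do rewrite EFinM.
  rewrite ge0_integralZl//.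
  + apply/measurable_EFinP; apply: mprod => i; exact: mh.
  + by rewrite lee_fin.
- by apply/measurable_EFinP; exact: mh.
- by move=> y _; rewrite lee_fin.
- by apply: integral_ge0 => x _; exact: k0.
Qed.

End lebesgue_tuple_integral.

Section gaussian_integral.
Context {R : realType} {d : nat}.
Local Notation mu := (lebesgue_tuple R d).
Local Notation TR := (measurableTypeR R).
Implicit Types (eps : R) (u x : 'cV[R]_d).

Lemma measurable_coord (i : 'I_d) :
  measurable_fun setT (fun t : d.-tuple TR => col_of_tuple t i 0).
Proof. by under eq_fun do rewrite mxE; exact: measurable_tnth. Qed.

Lemma coordB u x i : (u - x) i 0 = u i 0 - x i 0.
Proof. by rewrite !mxE. Qed.

(** The heat kernel factors into one-dimensional normal densities, which
    reduces its integral to theirs. *)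
Lemma gaussian_normal_pdf eps u x : 0 < eps ->
  gaussian eps (u - x) = \prod_i normal_pdf (x i 0) (Num.sqrt eps) (u i 0).
Proof.
move=> e0; have c0 : 0 < 2 * pi * eps by rewrite !mulr_gt0 ?pi_gt0.
under eq_bigr do rewrite normal_pdfE ?gt_eqF ?sqrtr_gt0//.
rewrite big_split/= prodr_const card_ord; congr (_ * _).
  rewrite /normal_peak sqr_sqrtr ?(ltW e0)// powRN exprVn; congr (_^-1).
  rewrite (mulrC d%:R) powRrM powR_mulrn ?powR_ge0// powR12_sqrt ?(ltW c0)//.
  by congr (Num.sqrt _ ^+ _); ring.
rewrite -expR_sum enorm_sqr /dotv -mulrN1 -!mulrA mulr_suml; congr expR.
apply: eq_bigr => i _; rewrite !mxE sqr_sqrtr ?(ltW e0)//.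
by field; rewrite gt_eqF.
Qed.

Lemma measurable_gaussian eps x :
  measurable_fun setT (fun t => gaussian eps (col_of_tuple t - x)).
Proof.
apply: measurable_funM => //; apply: measurableT_comp => //.
under eq_fun do rewrite enorm_sqr /dotv.
apply: measurableT_comp => //; apply: measurable_funM => //.
apply: measurable_sum => i; under eq_fun do rewrite coordB.
apply: measurable_funM; apply: measurable_funB => //; exact: measurable_coord.
Qed.

Lemma gaussian_gt0 eps u : 0 < eps -> 0 < gaussian eps u.
Proof.
by move=> e0; rewrite mulr_gt0 ?expR_gt0 ?powR_gt0// !mulr_gt0 ?pi_gt0.
Qed.

Lemma integral_gaussian eps x : 0 < eps ->
  (\int[mu]_t (gaussian eps (col_of_tuple t - x))%:E = 1)%E.
Proof.
move=> e0; transitivity (\prod_(i < d)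
    \int[@lebesgue_measure R]_y (normal_pdf (x i 0) (Num.sqrt eps) y)%:E)%E.
  rewrite -integral_lebesgue_tuple_prod; last first.
  - by move=> i y; exact: normal_pdf_ge0.
  - by move=> i; exact: measurable_normal_pdf.
  apply: eq_integral => t _; rewrite gaussian_normal_pdf//.
  by congr EFin; apply: eq_bigr => i _; rewrite mxE.
by rewrite big1// => i _; exact: integral_normal_pdf.
Qed.

Lemma integrable_gaussian eps x : 0 < eps ->
  mu.-integrable setT (fun t => (gaussian eps (col_of_tuple t - x))%:E).
Proof.
move=> e0; apply/integrableP; split.
  by apply/measurable_EFinP; exact: measurable_gaussian.
under eq_integral do rewrite /= ger0_norm ?(ltW (gaussian_gt0 _ _))//.
by rewrite integral_gaussian// ltry.
Qed.

Lemma integral_Rd_gaussian eps x : 0 < eps ->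
  integral_Rd (fun u => gaussian eps (u - x)) = 1.
Proof. by move=> e0; rewrite /integral_Rd /Rintegral integral_gaussian. Qed.

(** Up to a factor this is [gaussian eps] for [eps = 1 / (2 * b)]. *)
Lemma integrable_expR_dotv (b : R) : 0 < b ->
  mu.-integrable setT
    (fun t => (expR (- (b * dotv (col_of_tuple t) (col_of_tuple t))))%:E).
Proof.
move=> b0; have c0 : 0 < (2 * b)^-1 by rewrite invr_gt0 mulr_gt0.
have k0 : 0 < (2 * pi * (2 * b)^-1) `^ (- (d%:R / 2)) :> R.
  by rewrite powR_gt0// !mulr_gt0 ?pi_gt0.
have := integrableZl measurableT ((2 * pi * (2 * b)^-1) `^ (- (d%:R / 2)))^-1
  (integrable_gaussian 0 c0).
apply: eq_integrable => // t _; rewrite -EFinM /gaussian subr0 mulKf ?gt_eqF//.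
by rewrite enorm_sqr; congr (expR _)%:E; field; rewrite gt_eqF.
Qed.

End gaussian_integral.

(** * Bounds on translated Gaussians *)

Section gaussian_bounds.
Context {R : realType} {d : nat}.
Implicit Types (u x y : 'cV[R]_d) (a b eps r delta : R).

Lemma dotvBE u x : dotv (u - x) (u - x) = \sum_i (u i 0 - x i 0) ^+ 2.
Proof. by apply: eq_bigr => i _; rewrite coordB expr2. Qed.

Lemma dotvB_le u x : dotv (u - x) (u - x) <= 2 * (dotv u u + dotv x x).
Proof.
rewrite dotvBE -big_split mulr_sumr; apply: ler_sum => i _ /=.
by have := sqr_ge0 (u i 0 + x i 0); lra.
Qed.

Lemma dotvB_ge u x : dotv u u / 2 - dotv x x <= dotv (u - x) (u - x).
Proof.
rewrite dotvBE mulr_suml -sumrB; apply: ler_sum => i _ /=.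
by have := sqr_ge0 (u i 0 / 2 - x i 0); nra.
Qed.

Lemma normr_coord_le u i : `|u i 0| <= 1 + dotv u u.
Proof.
apply: (@le_trans _ _ (1 + u i 0 * u i 0)).
  by rewrite ler_norml; apply/andP; split; nra.
rewrite lerD2l /dotv (bigD1 i)//= lerDl sumr_ge0// => j _.
exact: sqr_ge0.
Qed.

(** Difference of two squares in each coordinate, followed by
    [2 * |s| <= 1 + s ^+ 2] to bound everything by [1 + dotv u u]. *)
Lemma dotvB_lipschitz u x y r delta : dotv x x <= r -> dotv y y <= r ->
  (forall i, `|x i 0 - y i 0| <= delta) -> 0 <= delta ->
  `|dotv (u - x) (u - x) - dotv (u - y) (u - y)| <=
    delta * ((3 * d%:R + 2 * r + 1) * (1 + dotv u u)).
Proof.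
move=> xr yr xy d0; have u0 := dotv_ge0 u.
have r0 : 0 <= r := le_trans (dotv_ge0 x) xr.
apply: (@le_trans _ _
  (delta * (3 * d%:R + dotv u u + dotv x x + dotv y y))); last first.
  have n0 : 0 <= d%:R :> R by [].
  by rewrite ler_wpM2l//; nra.
have -> : 3 * d%:R = \sum_(i < d) 3 :> R.
  by rewrite sumr_const card_ord mulr_natr.
rewrite !dotvBE -sumrB /dotv -!big_split/= mulr_sumr.
apply: le_trans (ler_norm_sum _ _ _) _; apply: ler_sum => i _.
have -> : (u i 0 - x i 0) ^+ 2 - (u i 0 - y i 0) ^+ 2 =
  (x i 0 - y i 0) * (x i 0 + y i 0 - 2 * u i 0) by ring.
rewrite normrM ler_pM// ler_norml; apply/andP.
have h s c := sqr_ge0 (s + c : R).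
have := h (x i 0) 1; have := h (y i 0) 1; have := h (u i 0) 1.
have := h (x i 0) (-1); have := h (y i 0) (-1); have := h (u i 0) (-1).
by rewrite !expr2; split; nra.
Qed.

Lemma expRN_lipschitz a b :
  `|expR (- a) - expR (- b)| <= `|a - b| * (expR (- a) + expR (- b)).
Proof.
wlog ab : a b / a <= b => [H|].
  have [/H//|/ltW/H] := leP a b.
  by rewrite distrC (distrC b) [expR (- b) + _]addrC.
have lo : expR (- b) <= expR (- a) by rewrite ler_expR lerN2.
rewrite ger0_norm ?subr_ge0// distrC ger0_norm ?subr_ge0//.
have -> : expR (- b) = expR (- a) * expR (a - b).
  by rewrite -expRD; congr expR; lra.
have h := expR_ge1Dx (a - b).
have : 0 <= (b - a) * (expR (- a) * expR (a - b)).
  by rewrite !mulr_ge0 ?expR_ge0// subr_ge0.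
have := expR_gt0 (- a); have := ab; rewrite -subr_ge0; nra.
Qed.

(** A Gaussian absorbs polynomial factors at the price of half its rate. *)
Lemma sqr_expRN_le b : 0 < b -> exists2 M, 0 <= M &
  forall s, 0 <= s ->
    (1 + s) ^+ 2 * expR (- (b * s)) <= M * expR (- (b / 2 * s)).
Proof.
move=> b0; pose c := 4 / b; have c0 : 0 < c by rewrite divr_gt0.
(* It suffices that [1 + s <= (1 + c) * (1 + s / c)] for every [c > 0], as
   [1 + s / c <= expR (s / c)]; the square then costs [expR (b / 2 * s)]. *)
exists ((1 + c) ^+ 2); first exact: sqr_ge0.
move=> s s0.
have -> : expR (- (b / 2 * s)) = expR (b / 4 * s) ^+ 2 * expR (- (b * s)).
  by rewrite expr2 -!expRD; congr expR; lra.
rewrite mulrA ler_pM2r ?expR_gt0// -exprMn ler_sqr ?nnegrE; first last.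
- by rewrite mulr_ge0 ?expR_ge0// addr_ge0// ltW.
- by rewrite addr_ge0.
have := expR_ge1Dx (b / 4 * s).
have -> : b / 4 * s = s / c by rewrite /c invf_div mulrC [RHS]mulrC; lra.
move=> h; apply: (@le_trans _ _ ((1 + c) * (1 + s / c))); last first.
  by rewrite ler_wpM2l// addr_ge0// ltW.
have : 0 <= s / c by rewrite divr_ge0// ltW.
have : c * (s / c) = s by rewrite mulrCA mulfV ?mulr1// gt_eqF.
by nra.
Qed.

Lemma gaussianE eps u : gaussian eps u =
  (2 * pi * eps) `^ (- (d%:R / 2)) * expR (- ((2 * eps)^-1 * dotv u u)).
Proof. by rewrite /gaussian enorm_sqr [(2 * eps)^-1 * _]mulrC. Qed.

(** The three bounds below compare [u - x] with [u], for [x] in a ball; the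
    cross term is absorbed by changing the rate [(2 * eps)^-1] by a factor 2. *)
Lemma gaussian_le eps r : 0 < eps -> exists2 K, 0 <= K & forall u x,
  dotv x x <= r ->
  gaussian eps (u - x) <= K * expR (- ((4 * eps)^-1 * dotv u u)).
Proof.
move=> e0; exists ((2 * pi * eps) `^ (- (d%:R / 2)) * expR ((2 * eps)^-1 * r)).
  by rewrite mulr_ge0 ?powR_ge0 ?expR_ge0.
move=> u x xr; rewrite gaussianE -[leRHS]mulrA ler_wpM2l ?powR_ge0//.
rewrite -expRD ler_expR.
have -> : (4 * eps)^-1 = (2 * eps)^-1 / 2 by field; rewrite gt_eqF.
have : 0 < (2 * eps)^-1 by rewrite invr_gt0 mulr_gt0.
by have := dotvB_ge u x; nra.
Qed.

Lemma gaussian_ge eps r : 0 < eps -> exists2 K, 0 < K & forall u x,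
  dotv x x <= r ->
  K * expR (- (eps^-1 * dotv u u)) <= gaussian eps (u - x).
Proof.
move=> e0; exists ((2 * pi * eps) `^ (- (d%:R / 2)) * expR (- (eps^-1 * r))).
  by rewrite mulr_gt0 ?powR_gt0 ?expR_gt0// !mulr_gt0 ?pi_gt0.
move=> u x xr; rewrite gaussianE -[leLHS]mulrA ler_wpM2l ?powR_ge0//.
rewrite -expRD ler_expR.
have -> : (2 * eps)^-1 = eps^-1 / 2 by field; rewrite gt_eqF.
have : 0 < eps^-1 by rewrite invr_gt0.
by have := dotvB_le u x; nra.
Qed.

Lemma gaussian_lipschitz eps r : 0 < eps -> exists2 K, 0 <= K &
  forall u x y delta, dotv x x <= r -> dotv y y <= r ->
  (forall i, `|x i 0 - y i 0| <= delta) -> 0 <= delta ->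
  `|gaussian eps (u - x) - gaussian eps (u - y)| <=
    delta * (K * ((1 + dotv u u) * expR (- ((4 * eps)^-1 * dotv u u)))).
Proof.
move=> e0; have [K K0 KP] := gaussian_le r e0.
have c0 : 0 < (2 * eps)^-1 by rewrite invr_gt0 mulr_gt0.
have [r0|r0] := leP 0 r; last first.
  exists 0 => // u x y delta xr.
  by have := le_lt_trans xr r0; rewrite ltNge dotv_ge0.
have m0 : 0 <= 3 * d%:R + 2 * r + 1 by rewrite !addr_ge0 ?mulr_ge0.
exists ((2 * eps)^-1 * (3 * d%:R + 2 * r + 1) * (2 * K)).
  by rewrite !mulr_ge0// ltW.
move=> u x y delta xr yr xy d0.
set g := (2 * pi * eps) `^ (- (d%:R / 2)).
have g0 : 0 <= g := powR_ge0 _ _.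
apply: (@le_trans _ _ (`|(2 * eps)^-1 * dotv (u - x) (u - x) -
  (2 * eps)^-1 * dotv (u - y) (u - y)| *
  (gaussian eps (u - x) + gaussian eps (u - y)))).
  rewrite !gaussianE -/g -mulrBr normrM ger0_norm// -mulrDr mulrCA.
  by rewrite ler_wpM2l// expRN_lipschitz.
rewrite -mulrBr normrM gtr0_norm//.
have := KP u x xr; have := KP u y yr.
set E := expR _ => gy gx.
have -> : delta * ((2 * eps)^-1 * (3 * d%:R + 2 * r + 1) * (2 * K) *
  ((1 + dotv u u) * E)) = (2 * eps)^-1 * (delta * ((3 * d%:R + 2 * r + 1) *
  (1 + dotv u u))) * (K * E + K * E) by ring.
apply: ler_pM.
- by rewrite mulr_ge0// ltW.
- by rewrite addr_ge0// ltW// gaussian_gt0.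
- by rewrite ler_pM2l// dotvB_lipschitz.
- exact: lerD.
Qed.

End gaussian_bounds.

(** * The integrand of the entropy *)

Section entropy_integrand.
Context {R : realType}.
Implicit Types a b y : R.

(** Subtracting [y] shifts the entropy by the mass, which is conserved, and
    makes the derivative exactly [ln y]. *)
Definition entropy_integrand y : R := y * ln y - y.

(** By convexity a chord lies between the tangents at its two ends. *)
Lemma entropy_integrand_lipschitz a b : 0 < a -> 0 < b ->
  `|entropy_integrand a - entropy_integrand b| <=
    `|a - b| * (`|ln a| + `|ln b|).
Proof.
have tangent x y : 0 < x -> 0 < y ->
    (x - y) * ln y <= entropy_integrand x - entropy_integrand y.
  move=> x0 y0; have yx0 : 0 < y / x by rewrite divr_gt0.
  have := expR_ge1Dx (ln (y / x)); rewrite lnK ?posrE// ln_div ?posrE//.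
  move=> /(ler_wpM2l (ltW x0)); rewrite mulrCA mulfV ?gt_eqF//.
  by rewrite /entropy_integrand; nra.
move=> a0 b0; have := tangent _ _ a0 b0; have := tangent _ _ b0 a0.
move=> h1 h2.
have k1 : (a - b) * ln a <= `|a - b| * `|ln a| by rewrite -normrM ler_norm.
have k2 : - ((a - b) * ln b) <= `|a - b| * `|ln b|.
  by rewrite -normrM -normrN ler_norm.
have k3 := mulr_ge0 (normr_ge0 (a - b)) (normr_ge0 (ln b)).
have k4 := mulr_ge0 (normr_ge0 (a - b)) (normr_ge0 (ln a)).
by rewrite ler_norml; apply/andP; split; lra.
Qed.

Lemma is_derive_entropy_integrand y : 0 < y ->
  is_derive y 1 entropy_integrand (ln y).
Proof.
move=> y0; have dln := is_derive1_ln y0.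
have := is_deriveB (is_deriveM (is_derive_id y 1) dln) (is_derive_id y 1).
move=> dd; apply: is_derive_eq dd _.
by rewrite /GRing.scale/= mulfV ?gt_eqF// mulr1 addrAC subrr add0r.
Qed.

End entropy_integrand.

(** * Bounds on the mollified density, uniform for bounded positions *)

Section density_bounds.
Context {R : realType} {d N : nat}.
Variables (eps : R) (w : 'I_N -> R).
Hypotheses (eps_gt0 : 0 < eps) (w_gt0 : forall k, 0 < w k) (N_gt0 : (0 < N)%N).
Implicit Types (u : 'cV[R]_d) (X Y : 'I_N -> 'cV[R]_d) (r delta a b : R).

Local Notation rho := (mollified_density eps w).
Local Notation n2 u := (dotv u u).

Let w_ge0 k : 0 <= w k. Proof. exact: ltW. Qed.

Lemma density_le r : exists2 K, 0 <= K & forall X u,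
  (forall k, n2 (X k) <= r) -> rho X u <= K * expR (- ((4 * eps)^-1 * n2 u)).
Proof.
have [K K0 KP] := @gaussian_le R d eps r eps_gt0.
exists (\sum_k w k * K); first by apply: sumr_ge0 => k _; rewrite mulr_ge0.
move=> X u Xr; rewrite mulr_suml; apply: ler_sum => k _.
by rewrite -mulrA ler_wpM2l// KP.
Qed.

Lemma density_ge r : exists2 K, 0 < K & forall X u,
  (forall k, n2 (X k) <= r) -> K * expR (- (eps^-1 * n2 u)) <= rho X u.
Proof.
have [K K0 KP] := @gaussian_ge R d eps r eps_gt0.
exists (\sum_k w k * K).
  rewrite -mulr_suml mulr_gt0//.
  rewrite (bigD1 (Ordinal N_gt0))//= ltr_pwDl// sumr_ge0//.
move=> X u Xr; rewrite mulr_suml; apply: ler_sum => k _.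
by rewrite -mulrA ler_wpM2l// KP.
Qed.

Lemma density_gt0 X u : 0 < rho X u.
Proof.
rewrite /mollified_density (bigD1 (Ordinal N_gt0))//= ltr_pwDl//.
  by rewrite mulr_gt0// gaussian_gt0.
by rewrite sumr_ge0// => k _; rewrite mulr_ge0// ltW// gaussian_gt0.
Qed.

Lemma density_lipschitz r : exists2 K, 0 <= K & forall X Y u delta,
  (forall k, n2 (X k) <= r) -> (forall k, n2 (Y k) <= r) ->
  (forall k i, `|X k i 0 - Y k i 0| <= delta) -> 0 <= delta ->
  `|rho X u - rho Y u| <=
    delta * (K * ((1 + n2 u) * expR (- ((4 * eps)^-1 * n2 u)))).
Proof.
have [K K0 KP] := @gaussian_lipschitz R d eps r eps_gt0.
exists (\sum_k w k * K); first by apply: sumr_ge0 => k _; rewrite mulr_ge0.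
move=> X Y u delta Xr Yr XY d0.
rewrite /mollified_density -sumrB mulr_suml mulr_sumr.
apply: le_trans (ler_norm_sum _ _ _) _; apply: ler_sum => k _.
rewrite -mulrBr normrM ger0_norm// -mulrA [leRHS]mulrCA ler_wpM2l//.
exact: KP.
Qed.

(** Gaussian tails from below keep the logarithm of the density quadratic. *)
Lemma ln_density_le r : exists2 K, 0 <= K & forall X u,
  (forall k, n2 (X k) <= r) -> `|ln (rho X u)| <= K * (1 + n2 u).
Proof.
have [K K0 KP] := density_le r; have [c c0 cP] := density_ge r.
exists (K + `|ln c| + eps^-1); first by rewrite !addr_ge0// invr_ge0 ltW.
move=> X u Xr; have u0 := dotv_ge0 u; have e0 : 0 < eps^-1 by rewrite invr_gt0.
have r0 := density_gt0 X u; have lc := ler_norm (ln c).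
have lcN := ler_norm (- ln c); rewrite normrN in lcN.
have E1 : expR (- ((4 * eps)^-1 * n2 u)) <= 1.
  by rewrite expR_le1 oppr_le0 mulr_ge0// invr_ge0 mulr_ge0// ltW.
have up : ln (rho X u) <= K.
  apply: (le_trans (ltW (ln_sublinear r0))); apply: le_trans (KP _ _ Xr) _.
  by rewrite ler_piMr.
have lo : ln c - eps^-1 * n2 u <= ln (rho X u).
  rewrite -[X in _ - X]opprK -[X in _ + X]expRK -lnM ?posrE ?expR_gt0// ?opprK.
  by rewrite ler_ln ?posrE ?mulr_gt0 ?expR_gt0// cP.
rewrite ler_norml; apply/andP; split; nra.
Qed.

(** The three bounds that dominate every integrand below. Each is a Gaussian of
    rate [(4 * eps)^-1] times a factor quadratic in [1 + dotv u u], which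
    [sqr_expRN_le] trades for the rate [(8 * eps)^-1]. *)
Lemma entropy_integrand_density_le r : exists K, forall X u,
  (forall k, n2 (X k) <= r) ->
  `|entropy_integrand (rho X u)| <= K * expR (- ((8 * eps)^-1 * n2 u)).
Proof.
have [K K0 KP] := density_le r; have [L L0 LP] := ln_density_le r.
have b0 : 0 < (4 * eps)^-1 by rewrite invr_gt0 mulr_gt0.
have [M M0 MP] := sqr_expRN_le b0.
exists (K * (L + 1) * M) => X u Xr.
have u0 := dotv_ge0 u; have r0 := density_gt0 X u.
have -> : entropy_integrand (rho X u) = rho X u * (ln (rho X u) - 1).
  by rewrite /entropy_integrand; ring.
have -> : (8 * eps)^-1 = (4 * eps)^-1 / 2 by field; rewrite gt_eqF.
rewrite -(mulrA _ M); apply: le_trans (ler_wpM2l _ (MP _ u0)); last first.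
  by rewrite mulr_ge0// addr_ge0.
rewrite normrM gtr0_norm//.
set E := expR _; have E0 : 0 < E := expR_gt0 _.
have -> : K * (L + 1) * ((1 + n2 u) ^+ 2 * E) =
  (K * E) * ((L + 1) * (1 + n2 u) ^+ 2) by ring.
apply: ler_pM => //; [exact: ltW|exact: KP|].
apply: le_trans (ler_normB _ _) _; rewrite normr1.
by have := LP X u Xr; nra.
Qed.

Lemma entropy_integrand_density_lipschitz r : exists2 K, 0 <= K &
  forall X Y u delta,
  (forall k, n2 (X k) <= r) -> (forall k, n2 (Y k) <= r) ->
  (forall k i, `|X k i 0 - Y k i 0| <= delta) -> 0 <= delta ->
  `|entropy_integrand (rho X u) - entropy_integrand (rho Y u)| <=
    delta * (K * expR (- ((8 * eps)^-1 * n2 u))).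
Proof.
have [K K0 KP] := density_lipschitz r; have [L L0 LP] := ln_density_le r.
have b0 : 0 < (4 * eps)^-1 by rewrite invr_gt0 mulr_gt0.
have [M M0 MP] := sqr_expRN_le b0.
exists (K * (2 * L) * M); first by rewrite !mulr_ge0.
move=> X Y u delta Xr Yr XY d0; have u0 := dotv_ge0 u.
apply: le_trans
  (entropy_integrand_lipschitz (density_gt0 X u) (density_gt0 Y u)) _.
have -> : (8 * eps)^-1 = (4 * eps)^-1 / 2 by field; rewrite gt_eqF.
rewrite -(mulrA _ M).
apply: le_trans (ler_wpM2l d0 (ler_wpM2l _ (MP _ u0))); last first.
  by rewrite !mulr_ge0.
set E := expR _; have E0 : 0 < E := expR_gt0 _.
have -> : delta * (K * (2 * L) * ((1 + n2 u) ^+ 2 * E)) =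
  (delta * (K * ((1 + n2 u) * E))) * (L * (1 + n2 u) + L * (1 + n2 u)) by ring.
by apply: ler_pM; rewrite ?addr_ge0// ?KP ?lerD ?LP.
Qed.

Lemma grad_gaussian_ln_density_le r : exists K, forall X u k i,
  (forall k, n2 (X k) <= r) ->
  `|(u i 0 - X k i 0) * gaussian eps (u - X k) * ln (rho X u)| <=
    K * expR (- ((8 * eps)^-1 * n2 u)).
Proof.
have [K K0 KP] := @gaussian_le R d eps r eps_gt0.
have [L L0 LP] := ln_density_le r.
have b0 : 0 < (4 * eps)^-1 by rewrite invr_gt0 mulr_gt0.
have [M M0 MP] := sqr_expRN_le b0.
exists (K * (2 * (r + 1) * L) * M) => X u k i Xr.
have r0 : 0 <= r := le_trans (dotv_ge0 (X k)) (Xr k).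
have u0 := dotv_ge0 u.
have -> : (8 * eps)^-1 = (4 * eps)^-1 / 2 by field; rewrite gt_eqF.
rewrite -(mulrA _ M); apply: le_trans (ler_wpM2l _ (MP _ u0)); last first.
  by rewrite !mulr_ge0// addr_ge0.
set E := expR _; have E0 : 0 < E := expR_gt0 _.
have -> : K * (2 * (r + 1) * L) * ((1 + n2 u) ^+ 2 * E) =
  (2 * (r + 1) * (1 + n2 u)) * (K * E) * (L * (1 + n2 u)) by ring.
rewrite 2!normrM; apply: ler_pM; rewrite ?mulr_ge0 ?LP//.
apply: ler_pM => //; last by rewrite gtr0_norm ?gaussian_gt0//; exact: KP.
rewrite -coordB; apply: le_trans (normr_coord_le _ _) _.
by have := dotvB_le u (X k); have := Xr k; nra.
Qed.

End density_bounds.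

(** * Derivatives along a curve, at a fixed point of space *)

Section pointwise_derivative.
Context {R : realType} {d : nat}.
Implicit Types (x : R -> 'cV[R]_d) (c : 'cV[R]_d) (eps t : R).

Lemma is_derive_coord x t c i :
  is_derive t 1 x c -> is_derive t 1 (fun s => x s i 0) (c i 0).
Proof.
move=> [dx <-]; rewrite derive_mx// mxE; apply: derivableP.
exact: ((derivable_mxP _ _ _).1 dx).
Qed.

Lemma is_derive_bigsum (V : normedModType R) n (f : 'I_n -> R -> V)
    (df : 'I_n -> V) t :
  (forall i, is_derive t 1 (f i) (df i)) ->
  is_derive t 1 (fun s => \sum_i f i s) (\sum_i df i).
Proof.
move=> fd; rewrite (_ : (fun s => _) = \sum_i f i); first exact: is_derive_sum.
by apply/funext => s; rewrite fct_sumE.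
Qed.

Lemma is_derive_dotv x t c : is_derive t 1 x c ->
  is_derive t 1 (fun s => dotv (x s) (x s)) (2 * dotv (x t) c).
Proof.
move=> dx; have dxi i := is_derive_coord i dx.
have dsum : is_derive t 1 (fun s => dotv (x s) (x s))
    (\sum_i (x t i 0 * c i 0 + x t i 0 * c i 0)).
  by apply: is_derive_bigsum => i; exact: is_deriveM.
apply: is_derive_eq dsum _.
by rewrite /dotv mulr_sumr; apply: eq_bigr => i _; ring.
Qed.

Lemma is_derive_gaussian eps x t c : is_derive t 1 x c ->
  is_derive t 1 (fun s => gaussian eps (x s))
    (- (eps^-1 * dotv (x t) c * gaussian eps (x t))).
Proof.
move=> dx; under eq_fun do rewrite gaussianE; rewrite gaussianE.
set g := _ `^ _; set a := (2 * eps)^-1.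
have d1 : is_derive t 1 (fun s => - (a * dotv (x s) (x s)))
    (- (a * (2 * dotv (x t) c))).
  have /(is_deriveZ a) := is_derive_dotv dx.
  exact: is_deriveN.
have d2 := is_derive1_comp (is_derive_expR _) d1.
have /= d3 := is_deriveZ g d2.
apply: is_derive_eq d3 _.
rewrite /GRing.scale/= /a invfM.
by set e := eps^-1; set D := dotv _ c; set E := expR _; field.
Qed.

(** A partial derivative is the derivative along a coordinate line. *)
Lemma gradient_gaussian eps (z : 'cV[R]_d) l :
  gradient (@gaussian R d eps) z l 0 = - (eps^-1 * z l 0 * gaussian eps z).
Proof.
rewrite mxE.
have dx : is_derive (0 : R) 1 (fun h : R => h *: delta_mx l 0 + z)
    (delta_mx l 0 : 'cV[R]_d).
  apply/is_derive1P/cvgrPdist_le => e e0; near=> s.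
  rewrite subr0 scale0r add0r addrK scalerA.
  rewrite mulVf ?scale1r ?subrr ?normr0 ?ltW//.
  by near: s; exact: nbhs_dnbhs_neq.
have := is_derive_gaussian eps dx; rewrite /= scale0r add0r dotv_delta.
move=> [_ <-]; rewrite /derive; congr (lim _).
apply: (congr1 (fun f : R -> R => f @ (0 : R)^')).
by apply/funext => h /=; rewrite /shift/= addr0 scaler1 scale0r add0r.
Unshelve. all: by end_near. Qed.

Lemma gaussianN eps (z : 'cV[R]_d) : gaussian eps (- z) = gaussian eps z.
Proof. by rewrite /gaussian enormN. Qed.

Lemma is_derive_lipschitz (f : R -> R) t l : is_derive t 1 f l ->
  \forall s \near t^', `|f s - f t| <= (`|l| + 1) * `|s - t|.
Proof.
move=> /is_derive1P/cvgrPdist_le/(_ 1 ltr01) fl; near=> s.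
have st : s - t != 0 by rewrite subr_eq0; near: s; exact: nbhs_dnbhs_neq.
have h : `|l - (s - t)^-1 * (f s - f t)| <= 1 by near: s; exact: fl.
rewrite -ler_pdivrMr ?normr_gt0// -normfV -normrM [X in `|X|]mulrC.
rewrite -lerBlDl; apply: le_trans (lerB_dist _ _) _.
by rewrite distrC.
Unshelve. all: by end_near. Qed.

End pointwise_derivative.

(** * Differentiation of the entropy under the integral *)

Section entropy_derivative.
Context {R : realType} {d N : nat}.
Variables (eps : R) (w : 'I_N -> R).
Hypotheses (eps_gt0 : 0 < eps) (w_gt0 : forall k, 0 < w k) (N_gt0 : (0 < N)%N).
Implicit Types (X : 'I_N -> 'cV[R]_d).

Local Notation mu := (lebesgue_tuple R d).
Local Notation TR := (measurableTypeR R).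
Local Notation rho := (mollified_density eps w).
Local Notation col := (@col_of_tuple R d).

Let b_gt0 : 0 < (8 * eps)^-1. Proof. by rewrite invr_gt0 mulr_gt0. Qed.

Lemma measurable_density X : measurable_fun setT (fun t => rho X (col t)).
Proof.
apply: measurable_sum => k; apply: measurable_funM => //.
exact: measurable_gaussian.
Qed.

Lemma measurable_entropy_integrand X :
  measurable_fun setT (fun t => entropy_integrand (rho X (col t))).
Proof.
have m := measurable_density X.
apply: measurable_funB => //; apply: measurable_funM => //.
exact: (measurableT_comp (@measurable_ln R)).
Qed.

Lemma measurable_grad_gaussian_ln X k i : measurable_fun setT (fun t =>
  (col t i 0 - X k i 0) * gaussian eps (col t - X k) * ln (rho X (col t))).
Proof.
apply: measurable_funM; last exact: (measurableT_comp (@measurable_ln R)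
  (measurable_density X)).
apply: measurable_funM; last exact: measurable_gaussian.
by apply: measurable_funB => //; exact: measurable_coord.
Qed.

Lemma integrable_le_expR (f : d.-tuple TR -> R) K b : 0 < b ->
  measurable_fun setT f ->
  (forall t, `|f t| <= K * expR (- (b * dotv (col t) (col t)))) ->
  mu.-integrable setT (EFin \o f).
Proof.
move=> b0 mf fK.
apply: le_integrable
  (integrableZl measurableT K (integrable_expR_dotv b0)) => //.
  exact/measurable_EFinP.
by move=> t _ /=; rewrite lee_fin (le_trans (fK t))// ler_norm.
Qed.

Lemma bounded_family X : exists r, forall k, dotv (X k) (X k) <= r.
Proof.
exists (\sum_k dotv (X k) (X k)) => k.
by rewrite (bigD1 k)//= lerDl sumr_ge0// => j _; exact: dotv_ge0.
Qed.

Lemma integrable_entropy_integrand X :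
  mu.-integrable setT (fun t => (entropy_integrand (rho X (col t)))%:E).
Proof.
have [r Xr] := bounded_family X.
have [K KP] := @entropy_integrand_density_le R d N eps w eps_gt0 w_gt0 N_gt0 r.
apply: (integrable_le_expR b_gt0 (measurable_entropy_integrand X)) => t.
exact: KP.
Qed.

Lemma integrable_grad_gaussian_ln X k i : mu.-integrable setT (fun t =>
  ((col t i 0 - X k i 0) * gaussian eps (col t - X k) * ln (rho X (col t)))%:E).
Proof.
have [r Xr] := bounded_family X.
have [K KP] := @grad_gaussian_ln_density_le R d N eps w eps_gt0 w_gt0 N_gt0 r.
apply: (integrable_le_expR b_gt0 (measurable_grad_gaussian_ln X k i)) => t.
exact: KP.
Qed.

Lemma Rintegral_sum (I : Type) (s : seq I) (f : I -> d.-tuple TR -> R) :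
  (forall i, mu.-integrable setT (EFin \o f i)) ->
  \int[mu]_t (\sum_(i <- s) f i t) = \sum_(i <- s) \int[mu]_t f i t.
Proof.
move=> fi; rewrite /Rintegral.
under eq_integral do rewrite -sumEFin.
rewrite integral_sum//.
by rewrite -sum_fine// => i _; exact: (integrable_fin_num _ (fi i)).
Qed.

Lemma integrable_scale (a : R) (f : d.-tuple TR -> R) :
  mu.-integrable setT (EFin \o f) ->
  mu.-integrable setT (fun t => (a * f t)%:E).
Proof. by move=> fi; under eq_fun do rewrite EFinM; exact: integrableZl. Qed.

Lemma integrable_density X : mu.-integrable setT (fun t => (rho X (col t))%:E).
Proof.
under eq_fun do rewrite -sumEFin.
apply: integrable_sum => // k _; exact/integrable_scale/integrable_gaussian.
Qed.

(** The mass is independent of the positions, hence constant in time. *)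
Lemma integral_Rd_density X : integral_Rd (rho X) = \sum_k w k.
Proof.
rewrite /integral_Rd Rintegral_sum; last first.
  by move=> k; exact/integrable_scale/integrable_gaussian.
apply: eq_bigr => k _.
by rewrite RintegralZl ?[Rintegral _ _ _]integral_Rd_gaussian ?mulr1//;
  exact: integrable_gaussian.
Qed.

Lemma entropyE X : entropy eps w X =
  integral_Rd (fun u => entropy_integrand (rho X u)) + \sum_k w k.
Proof.
rewrite -(integral_Rd_density X) /integral_Rd -RintegralD//; last 2 first.
- exact: integrable_entropy_integrand.
- exact: integrable_density.
by apply: eq_Rintegral => t _; rewrite /entropy_integrand subrK.
Qed.

(** The Gaussian is even, so its gradient at [X k - u] is expressed by the
    translate [u - X k] that enters the density. *)
Lemma grad_entropy_variationE X k i :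
  grad_entropy_variation eps w X (X k) i 0 = eps^-1 *
  integral_Rd (fun u =>
    (u i 0 - X k i 0) * gaussian eps (u - X k) * ln (rho X u)).
Proof.
rewrite mxE /integral_Rd -RintegralZl//; last first.
  exact: integrable_grad_gaussian_ln.
apply: eq_Rintegral => t _.
rewrite gradient_gaussian -gaussianN opprB coordB; ring.
Qed.

Section along_a_curve.
Variables (x : 'I_N -> R -> 'cV[R]_d) (c : 'I_N -> 'cV[R]_d) (t : R).
Hypothesis dx : forall k, is_derive t 1 (x k) (c k).

Let X s : 'I_N -> 'cV[R]_d := fun k => x k s.

Definition density_derivative (u : 'cV[R]_d) : R := \sum_k w k *
  (eps^-1 * dotv (u - x k t) (c k) * gaussian eps (u - x k t)).

Lemma is_derive_entropy_density u :
  is_derive t 1 (fun s => entropy_integrand (rho (X s) u))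
    (ln (rho (X t) u) * density_derivative u).
Proof.
apply: (@is_derive1_comp _ (@entropy_integrand R) (fun s => rho (X s) u)).
  exact/is_derive_entropy_integrand/density_gt0.
apply: is_derive_bigsum => k.
have dk : is_derive t 1 (fun s => u - x k s) (- c k).
  rewrite -[X in is_derive _ _ _ X]sub0r; apply: is_deriveB.
have := is_deriveZ (w k) (is_derive_gaussian eps dk).
by move=> dd; apply: is_derive_eq dd _; rewrite dotvNr mulrN mulNr opprK.
Qed.

(** Only differentiability at [t] is available, hence a Lipschitz bound with one
    end of the increment at [t]. *)
Lemma curve_lipschitz : exists2 C, 0 <= C &
  \forall s \near t^', forall k i, `|x k s i 0 - x k t i 0| <= C * `|s - t|.
Proof.
pose C := \sum_(k < N) \sum_(i < d) (`|c k i 0| + 1).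
have c0 k i : 0 <= `|c k i 0| + 1 by rewrite addr_ge0.
have Cki k i : `|c k i 0| + 1 <= C.
  apply: (@le_trans _ _ (\sum_(j < d) (`|c k j 0| + 1))).
    by rewrite (bigD1 i)//= lerDl sumr_ge0.
  by rewrite /C (bigD1 k)//= lerDl sumr_ge0// => j _; rewrite sumr_ge0.
exists C.
  by rewrite sumr_ge0// => k _; rewrite sumr_ge0.
apply: filter_forall => k; apply: filter_forall => i.
have := is_derive_lipschitz (is_derive_coord i (dx k)).
apply: filterS => s /le_trans; apply.
by rewrite ler_wpM2r.
Qed.

(** The dominating function: near [t] the positions stay in a fixed ball, on
    which the integrand is Lipschitz in the positions. *)
Lemma difference_quotient_le : exists K, \forall s \near t^', forall u,
  `|(s - t)^-1 * (entropy_integrand (rho (X s) u) -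
                  entropy_integrand (rho (X t) u))| <=
    K * expR (- ((8 * eps)^-1 * dotv u u)).
Proof.
have [C C0 xC] := curve_lipschitz.
(* For [|s - t| <= 1] each coordinate moves by at most [C]. *)
pose r := \sum_k \sum_i (`|x k t i 0| + C) ^+ 2.
have bound s : `|s - t| <= 1 ->
    (forall k i, `|x k s i 0 - x k t i 0| <= C * `|s - t|) ->
    forall k, dotv (X s k) (X s k) <= r.
  move=> st sC k; rewrite /r (bigD1 k)//=.
  apply: ler_wpDr.
    by apply: sumr_ge0 => j _; apply: sumr_ge0 => i _; exact: sqr_ge0.
  apply: ler_sum => i _; rewrite -expr2 -real_normK ?num_real//.
  rewrite ler_sqr ?nnegrE ?addr_ge0// -lerBlDl.
  apply: le_trans (lerB_dist _ _) _; apply: (le_trans (sC k i)).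
  by rewrite ler_piMr.
have [K K0 KP] :=
  @entropy_integrand_density_lipschitz R d N eps w eps_gt0 w_gt0 N_gt0 r.
have near1 : \forall s \near t^', `|s - t| <= 1.
  by apply: nbhs_dnbhs; exists 1 => //= s; rewrite /ball_/= distrC => /ltW.
exists (C * K); near=> s => u.
have st : s - t != 0 by rewrite subr_eq0; near: s; exact: nbhs_dnbhs_neq.
have sC k i : `|x k s i 0 - x k t i 0| <= C * `|s - t|.
  by move: k i; near: s; exact: xC.
have st1 : `|s - t| <= 1 by near: s; exact: near1.
rewrite normrM normfV mulrC ler_pdivrMr ?normr_gt0//.
have -> : C * K * expR (- ((8 * eps)^-1 * dotv u u)) * `|s - t| =
  C * `|s - t| * (K * expR (- ((8 * eps)^-1 * dotv u u))) by ring.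
apply: KP => //; last by rewrite mulr_ge0.
- exact: bound.
- by apply: bound => [|k i]; rewrite !subrr normr0 ?mulr0.
Unshelve. all: by end_near. Qed.

Lemma is_derive_integral_entropy_integrand : is_derive t 1
  (fun s => integral_Rd (fun u => entropy_integrand (rho (X s) u)))
  (integral_Rd (fun u => ln (rho (X t) u) * density_derivative u)).
Proof.
have [K Kquot] := difference_quotient_le.
apply/is_derive1P/cvgr_dnbhsP => a [a_neq a_cvg].
have [m _ am] : \forall n \near \oo, forall u,
    `|(a n - t)^-1 * (entropy_integrand (rho (X (a n)) u) -
        entropy_integrand (rho (X t) u))| <=
    K * expR (- ((8 * eps)^-1 * dotv u u)).
  have := a_cvg _ Kquot; rewrite /= nbhs_filterE /=.
  by apply: filterS => n /=; apply; exact: a_neq.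
(* The domination only holds from rank [m] on. *)
rewrite -(cvg_shiftn m).
pose q n u := (a (n + m)%N - t)^-1 *
  (entropy_integrand (rho (X (a (n + m)%N)) u) -
   entropy_integrand (rho (X t) u)).
have mq n : measurable_fun setT (fun z : d.-tuple TR => q n (col z)).
  apply: measurable_funM => //.
  by apply: measurable_funB; exact: measurable_entropy_integrand.
have mf : measurable_fun setT (fun z : d.-tuple TR =>
    ln (rho (X t) (col z)) * density_derivative (col z)).
  apply: measurable_funM.
    exact: (measurableT_comp (@measurable_ln R) (measurable_density _)).
  apply: measurable_sum => k; apply: measurable_funM => //.
  apply: measurable_funM; last exact: measurable_gaussian.
  apply: measurable_funM => //; apply: measurable_sum => i.
  apply: measurable_funM => //; under eq_fun do rewrite coordB.
  by apply: measurable_funB => //; exact: measurable_coord.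
have [] := @dominated_convergence _ _ _ mu setT measurableT
  (fun n z => (q n (col z))%:E)
  (fun z => (ln (rho (X t) (col z)) * density_derivative (col z))%:E)
  (fun z => (K * expR (- ((8 * eps)^-1 * dotv (col z) (col z))))%:E).
- by move=> n; apply/measurable_EFinP; exact: mq.
- by apply/measurable_EFinP; exact: mf.
- apply: aeW => z _; apply: cvg_EFin; first exact: nearW.
  have /is_derive1P/cvgr_dnbhsP/(_ a) := is_derive_entropy_density (col z).
  move=> /(_ (conj a_neq a_cvg)) h.
  rewrite (_ : fine \o _ = (fun n => q n (col z))); last exact: funext.
  exact: (cvg_comp (fun n => n + m)%N _ (cvg_addnr m) h).
- exact: (integrableZl measurableT K (integrable_expR_dotv b_gt0)).
- by apply: aeW => z n _; rewrite lee_fin; apply: am; rewrite /= leq_addl.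
move=> fint _; rewrite -[X in _ --> X -> _]fineK ?integrable_fin_num//.
move=> /fine_cvg; apply: cvg_trans; apply: near_eq_cvg; apply: nearW => n.
rewrite /= /GRing.scale/= /integral_Rd -RintegralB//; first last.
- exact: integrable_entropy_integrand.
- exact: integrable_entropy_integrand.
rewrite -RintegralZl//.
exact: (integrableB measurableT (integrable_entropy_integrand _)
  (integrable_entropy_integrand _)).
Qed.

(** Linearity of the integral turns the derivative of the density into the
    gradients of the entropy variation at the particles. *)
Lemma integral_density_derivative :
  integral_Rd (fun u => ln (rho (X t) u) * density_derivative u) =
  \sum_k w k * dotv (grad_entropy_variation eps w (X t) (x k t)) (c k).
Proof.
have int k i (C : R) : mu.-integrable setT (EFin \o (fun z => C *
    ((col z i 0 - x k t i 0) * gaussian eps (col z - x k t) *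
     ln (rho (X t) (col z))))).
  exact/integrable_scale/(integrable_grad_gaussian_ln (X t) k i).
pose C k i := w k * (eps^-1 * c k i 0).
transitivity (\int[mu]_z \sum_k \sum_i C k i *
    ((col z i 0 - x k t i 0) * gaussian eps (col z - x k t) *
     ln (rho (X t) (col z)))).
  apply: eq_Rintegral => z _; rewrite mulr_sumr; apply: eq_bigr => k _.
  rewrite /dotv !mulr_sumr mulr_suml !mulr_sumr; apply: eq_bigr => i _.
  by rewrite coordB /C; ring.
rewrite Rintegral_sum; last first.
  move=> k; rewrite (_ : EFin \o _ = fun z => (\sum_i (C k i *
    ((col z i 0 - x k t i 0) * gaussian eps (col z - x k t) *
      ln (rho (X t) (col z))))%:E)%E).
    by apply: integrable_sum => // i _; exact: int.
  by apply/funext => z /=; rewrite sumEFin.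
apply: eq_bigr => k _; rewrite Rintegral_sum// mulr_sumr.
apply: eq_bigr => i _; rewrite RintegralZl//; last first.
  exact: (integrable_grad_gaussian_ln (X t) k i).
rewrite (grad_entropy_variationE (X t) k i) /C /integral_Rd /X.
by set J := Rintegral _ _ _; ring.
Qed.

(** In other words, [w k *: grad_entropy_variation eps w x (x k)] is the
    gradient of the entropy in the position of particle [k]. *)
Lemma is_derive_entropy : is_derive t 1 (fun s => entropy eps w (X s))
  (\sum_k w k * dotv (grad_entropy_variation eps w (X t) (x k t)) (c k)).
Proof.
under eq_fun do rewrite entropyE.
rewrite -integral_density_derivative -[X in is_derive _ _ _ X]addr0.
exact: (is_deriveD is_derive_integral_entropy_integrand).
Qed.

End along_a_curve.

End entropy_derivative.

(** * Conservation laws and dissipation *)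

Section conservation.
Context {R : realType} {d N : nat}.
Variables (Lambda gamma eps : R) (p : nat) (P : {set {set 'I_N}}).
Variables (w : 'I_N -> R) (x : 'I_N -> 'cV[R]_d).

Local Notation c := (batch_velocity Lambda gamma eps p P w x).

Lemma batch_momentum_rate : \sum_i w i *: c i = 0.
Proof.
apply/colP => l; rewrite summxE mxE.
transitivity (\sum_i w i * dotv (delta_mx l 0) (c i)).
  by apply: eq_bigr => i _; rewrite mxE dotvC dotv_delta.
rewrite (batch_velocity_weak _ _ _ _ _ _ _ (fun=> delta_mx l 0)).
rewrite big1 ?mulr0 ?oppr0// => i _; rewrite big1// => j _; rewrite subrr.
by rewrite /dotv big1 ?mulr0// => m _; rewrite mxE mul0r.
Qed.

Lemma batch_energy_rate : \sum_i w i * (2 * dotv (x i) (c i)) = 0.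
Proof.
under eq_bigr do rewrite mulrCA.
rewrite -mulr_sumr batch_velocity_weak big1 ?mulr0 ?oppr0 ?mulr0// => i _.
by rewrite big1// => j _; rewrite dotv_collision_matrix mulr0.
Qed.

Lemma batch_entropy_rate :
  \sum_i w i * dotv (grad_entropy_variation eps w x (x i)) (c i) =
  - batch_dissipation Lambda gamma eps p P w x.
Proof. exact: batch_velocity_weak. Qed.

Lemma batch_dissipation_ge0 : 0 <= Lambda -> (0 < p <= N)%N ->
  (forall i, 0 <= w i) -> 0 <= batch_dissipation Lambda gamma eps p P w x.
Proof.
move=> L0 /andP[p0 pN] w0; rewrite /batch_dissipation mulr_ge0//.
  rewrite divr_ge0 ?mulr_ge0 ?subr_ge0 ?ler1n//.
  exact: leq_trans pN.
apply: sumr_ge0 => i _; apply: sumr_ge0 => j _.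
by rewrite !mulr_ge0// collision_matrix_ge0.
Qed.

End conservation.

Theorem proposition3p1 (R : realType) (d N p : nat) (Lambda gamma eps : R)
    (w : 'I_N -> R) (P : {set {set 'I_N}}) (J : interval R)
    (v : 'I_N -> R -> 'cV[R]_d) :
  (2 <= d)%N -> 0 < Lambda -> - d%:R - 1 <= gamma <= 1 -> 0 < eps ->
  (2 <= p <= N)%N -> (p %| N)%N -> is_batching p P ->
  (forall i, 0 < w i) ->
  (forall t, t \in J -> forall i,
    is_derive_on J (v i) t
      (batch_velocity Lambda gamma eps p P w (fun k => v k t) i)) ->
  (forall t, t \in J ->
    [/\ is_derive_on J (fun=> \sum_i w i : R^o) t 0,
        is_derive_on J (fun s => \sum_i w i *: v i s) t 0
      & is_derive_on J (fun s => \sum_i w i * enorm (v i s) ^+ 2 : R^o) t 0])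
  /\
  (forall t, t \in J ->
    is_derive_on J (fun s => entropy eps w (fun k => v k s) : R^o) t
      (- batch_dissipation Lambda gamma eps p P w (fun k => v k t))
    /\ - batch_dissipation Lambda gamma eps p P w (fun k => v k t) <= 0).
Proof.
move=> _ L0 _ e0 /andP[p2 pN] _ _ w0 dv.
have p0 : (0 < p)%N by exact: ltnW.
have N0 : (0 < N)%N by exact: leq_trans pN.
have ext t : t \in J -> exists g : 'I_N -> R -> 'cV[R]_d,
    (forall k, is_derive t 1 (g k)
      (batch_velocity Lambda gamma eps p P w (fun k => v k t) k)) /\
    (forall s, s \in J -> forall k, g k s = v k s).
  move=> tJ.
  have : forall k, exists gk : R -> 'cV[R]_d, is_derive t 1 gk
      (batch_velocity Lambda gamma eps p P w (fun k => v k t) k) /\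
      {in J, gk =1 v k}.
    by move=> k; have [gk] := is_derive_on_extension (dv t tJ k) tJ; exists gk.
  move=> /choice[g gP]; exists g; split=> [k|s sJ k]; first exact: (gP k).1.
  exact: (gP k).2.
split=> t tJ; have [g [dg gv]] := ext t tJ.
  split.
  - exact: (is_derive_is_derive_on (is_derive_cst _ _ _) tJ).
  - have := is_derive_bigsum (fun i => is_deriveZ (w i) (dg i)).
    rewrite batch_momentum_rate => dmomentum.
    apply: (is_derive_is_derive_on dmomentum tJ) => s sJ.
    by apply: eq_bigr => i _; rewrite /= gv.
  - have := is_derive_bigsum
      (fun i => is_deriveZ (w i) (is_derive_dotv (dg i))).
    rewrite /GRing.scale/=.
    under eq_bigr do rewrite gv//.
    rewrite batch_energy_rate => denergy.
    apply: (is_derive_is_derive_on denergy tJ) => s sJ.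
    by apply: eq_bigr => i _; rewrite gv// enorm_sqr.
split; last first.
  rewrite oppr_le0; apply: batch_dissipation_ge0; rewrite ?p0 ?pN ?ltW//.
  by move=> i; exact: ltW.
have gvt s : s \in J -> g^~ s = v^~ s.
  by move=> sJ; apply/funext => k; exact: gv.
have := is_derive_entropy e0 w0 N0 dg.
rewrite gvt//; under eq_bigr do rewrite gv//.
rewrite batch_entropy_rate => dentropy.
by apply: (is_derive_is_derive_on dentropy tJ) => s sJ; rewrite gvt.
Qed.
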